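(* Let $S\subseteq F_*$ be strictly non-expanding, let $\mathcal{I}$ be the ideal generated by $S$ in $F_*$, and let $A=F_*/\mathcal{I}$ be the quotient $*$-algebra, identified as a vector space with $K$. Let $\phi$ be an enumeration of $BW$ and let $\xi=\{a_k\}_{k\in\mathbb{N}}\subset\mathbb{N}$ be a sequence for which the form $\langle\cdot,\cdot\rangle_\xi$ is positive definite. Then the right regular representation $z\mapsto L_z$, $L_z(f)=fz$ ($z,f\in A$), of $A$ on the pre-Hilbert space $(K,\langle\cdot,\cdot\rangle_\xi)$ is a faithful $*$-representation.
   Context: $F_*$ is the free associative algebra over $\mathbb{C}$ on generators $x_1,\dots,x_m,x_1^*,\dots,x_m^*$, with the (conjugate-linear, anti-multiplicative) involution determined by $(x_j)^*=x_j^*$. $W$ is the set of all words (including the empty one) in the $2m$ generators; elements of $F_*$ are finite linear combinations of words. A linear order on the generators is fixed, and words are ordered by length first and then lexicographically. $|w|$ is the length of $w$. For $f\in F_*$ and $z\in W$, $z\prec f$ means that $z$ has nonzero coefficient in $f$. For $f\neq 0$, $\hat f$ is the greatest word $z\prec f$. Elements $f,g$ form a composition $w=xyz$ if there are words $x,z$ and a nonempty word $y$ with $\hat f=xy$, $\hat g=yz$; its result is $(f,g)_w=\beta fz-\alpha xg$, where $\alpha,\beta$ are the leading coefficients of $f,g$. A set $S\subseteq F_*$ (of nonzero elements) is closed under compositions if for all $f,g\in S$: (i) if $f\ne g$ then $\hat f$ is not a subword of $\hat g$; (ii) if $f,g$ form a composition $w$, then $(f,g)_w=\sum_j\alpha_j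 a_jf_jb_j$ for some words $a_j,b_j$, $f_j\in S$, $\alpha_j\in\mathbb{C}$, where the greatest word of each $a_jf_jb_j$ is less than $w$. $S$ is symmetric if the two-sided ideal $\mathcal I$ it generates satisfies $\mathcal I^*=\mathcal I$. For $S$ closed under compositions, $BW$ is the set of words containing no $\hat s$ ($s\in S$) as a subword; it is a linear basis of $F_*/\mathcal{I}$. $K$ is the linear span of $BW$, and $\mathrm{R}_S(f)$ is the unique element of $K$ with $f-\mathrm{R}_S(f)\in\mathcal{I}$. $K$ with the product $f\diamond g=\mathrm{R}_S(fg)$ is isomorphic to $F_*/\mathcal{I}$. A symmetric $S$ closed under compositions is non-expanding if for all $u,v,w\in BW$ with $u\neq v$ and $ww^*\prec\mathrm{R}_S(uv^* )$ one has $w<u$ or $w<v$. It is strictly non-expanding if in addition $dd^*\in BW$ for every $d\in BW$. An enumeration of $BW$ is a bijection $\phi$ from $BW$ onto $\{1,\dots,|BW|\}$ (or onto $\mathbb{N}=\{1,2,\dots\}$ if $BW$ is infinite) such that $u>v$ implies $\phi(u)>\phi(v)$. $\mathrm{H}:F_*\to F_*$ is the linear operator with $\mathrm{H}(uu^* )=u$ for $u\in W$ and $\mathrm{H}(v)=0$ if the word $v$ is not of the form $uu^*$. For a sequence $\xi=\{a_k\}$ of positive reals, $T^\phi_\xi:K\to\mathbb{C}$ is the linear functional with $T^\phi_\xi(u)=a_{\phi(u)}$ for $u\in BW$. The sesquilinear form $\langle\cdot,\cdot\rangle_\xi$ on $K$ (linear in the first argument) is given by $\langle u,u\rangle_\xi=a_{\phi(u)}$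 and $\langle u,v\rangle_\xi=T^\phi_\xi(\mathrm{H}(\mathrm{R}_S(uv^* )))$ for $u\ne v$ in $BW$. (For strictly non-expanding $S$ a sequence $\xi\subset\mathbb{N}$ making this form positive definite exists.) ''$*$-representation'' for the right regular representation: $A$ acts by right multiplication (so products act in the order $L_{zw}=L_w\circ L_z$), and $\langle L_z f,g\rangle_\xi=\langle f,L_{z^*}g\rangle_\xi$ for all $f,g\in K$; faithful means $L_z\neq0$ for $z\ne0$. *)

(* Defs.v *)
From HB Require Import structures.
From mathcomp Require Import all_boot all_order all_algebra generic_quotient ring_quotient.
From mathcomp Require Import finmap monalg complex.
From mathcomp Require Import boolp classical_sets functions cardinality reals.

Set Implicit Arguments.
Unset Strict Implicit.
Unset Printing Implicit Defensive.

Import Order.TTheory GRing.Theory Num.Theory.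
Local Open Scope classical_set_scope.
Local Open Scope quotient_scope.
Local Open Scope ring_scope.

(* The letter (j, false) is x_j and the letter (j, true) is x_j^*. *)
Notation letter m := ('I_m * bool)%type (only parsing).

Definition word (m : nat) : Type := seq (letter m).
HB.instance Definition _ m := Choice.copy (word m) (seq (letter m)).

Lemma word_unitm m (u v : word m) : u ++ v = [::] -> u = [::] /\ v = [::].
Proof. by case: u => //=; case: v. Qed.

HB.instance Definition _ m := Choice_isMonomialDef.Build (word m)
  (@catA (letter m)) (@cat0s (letter m)) (@cats0 (letter m)) (@word_unitm m).

(* F_* : since the product of the monoid [word m] is concatenation, the monoid
   algebra is the free associative algebra on the 2m letters. *)
Notation falg R m := {malg R[i][word m]}.

Definition wd (R : realType) (m : nat) (w : word m) : falg R m := << w >>.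
Arguments wd R {m} w.

Definition wstar (m : nat) (w : word m) : word m :=
  rev [seq (x.1, ~~ x.2) | x <- w].

Definition star (R : realType) (m : nat) (f : falg R m) : falg R m :=
  \sum_(w <- msupp f) (f@_w)^* *: wd R (wstar w).

Definition linear_order (T : eqType) (le : rel T) : Prop :=
  [/\ reflexive le, antisymmetric le, transitive le & total le].

Section WordOrder.
Context (R : realType) (m : nat) (le : rel (letter m)).

Fixpoint lex_lt (u v : seq (letter m)) : bool :=
  match u, v with
  | [::], [::] => false
  | [::], _ :: _ => true
  | _ :: _, [::] => false
  | x :: u', y :: v' =>
      (x != y) && le x y || (x == y) && lex_lt u' v'
  end.

Definition wlt (u v : word m) : bool :=
  (size u < size v)%N || (size u == size v) && lex_lt u v.

Definition wmax (u v : word m) : word m := if wlt u v then v else u.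

(* The empty word is the least word, hence it can start the iteration; it is
   also the (meaningless) value of [lead 0]. *)
Definition lead (f : falg R m) : word m := \big[wmax/[::]]_(w <- msupp f) w.

Definition leadc (f : falg R m) : R[i] := f@_(lead f).

End WordOrder.

Section TwoSidedIdeal.
Context (R : realType) (m : nat).
Implicit Types (S I : set (falg R m)).

Definition is_ideal I : Prop :=
  [/\ I 0, forall f g, I f -> I g -> I (f + g),
      forall a f, I f -> I (a * f) & forall a f, I f -> I (f * a)].

Definition ideal S : set (falg R m) := smallest is_ideal S.

Lemma ideal_is_ideal S : is_ideal (ideal S).
Proof.
split=> [I [[]]//|f g If Ig I IS|a f If I IS|a f If I IS].
- by have [[_ D _ _] _] := IS; apply: D; [exact: If|exact: Ig].
- by have [[_ _ M _] _] := IS; apply: M; exact: If.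
- by have [[_ _ _ M] _] := IS; apply: M; exact: If.
Qed.

Definition idealp S : pred (falg R m) := fun f => `[< ideal S f >].

Lemma idealp_zmod_closed S : zmod_closed (idealp S).
Proof.
have [I0 ID IMl _] := ideal_is_ideal S; split=> [|f g]; first exact/asboolP.
move=> /asboolP If /asboolP Ig; apply/asboolP; apply: (ID _ _ If).
by rewrite -mulN1r; apply: IMl.
Qed.
HB.instance Definition _ S := GRing.isZmodClosed.Build (falg R m) (idealp S)
  (idealp_zmod_closed S).
Definition idealz S : zmodClosed (falg R m) :=
  GRing.ZmodClosed.clone (falg R m) (idealp S) _.

Lemma idealpMl S a f : f \in idealp S -> a * f \in idealp S.
Proof. by have [_ _ M _] := ideal_is_ideal S => /asboolP /(M a) /asboolP. Qed.

Lemma idealpMr S a f : f \in idealp S -> f * a \in idealp S.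
Proof. by have [_ _ _ M] := ideal_is_ideal S => /asboolP /(M a) /asboolP. Qed.

Lemma idealpZ S (c : R[i]) f : f \in idealp S -> c *: f \in idealp S.
Proof. by move=> /(idealpMl c%:A); rewrite -scalerAl mul1r. Qed.

End TwoSidedIdeal.

(* The quotient algebra A = F_* / I. The unital ring structure allows 1 = 0,
   since I may be the whole of F_*. *)
Section QuotientAlgebra.
Context (R : realType) (m : nat) (S : set (falg R m)).

Definition quotalg : Type := Quotient.quot (idealz S).
HB.instance Definition _ := GRing.Zmodule.on quotalg.

Definition qpi (f : falg R m) : quotalg := \pi_(Quotient.quot (idealz S)) f.
Definition qrepr (a : quotalg) : falg R m :=
  repr (a : Quotient.quot (idealz S)).

Definition qone : quotalg := qpi 1.
Definition qmul (a b : quotalg) : quotalg := qpi (qrepr a * qrepr b).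
Definition qscale (c : R[i]) (a : quotalg) : quotalg := qpi (c *: qrepr a).
(* An involution on A as soon as I^* = I. *)
Definition qstar (a : quotalg) : quotalg := qpi (star (qrepr a)).

Lemma qreprK a : qpi (qrepr a) = a. Proof. exact: reprK. Qed.

Lemma qpiP f g : qpi f = qpi g <-> f - g \in idealp S.
Proof.
by rewrite /qpi; split=> [/eqP|fg]; [|apply/eqP]; rewrite -Quotient.idealrBE.
Qed.

Lemma qrepr_pi f : qrepr (qpi f) - f \in idealp S.
Proof. by apply/qpiP; rewrite qreprK. Qed.

Lemma qpiD f g : qpi (f + g) = qpi f + qpi g.
Proof. exact: (raddfD (\pi_(Quotient.quot (idealz S)))). Qed.

Lemma qpiM f g : qpi (f * g) = qmul (qpi f) (qpi g).
Proof.
apply/qpiP; rewrite -opprB rpredN.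
rewrite -(subrK (qrepr (qpi f) * g) (qrepr _ * _)) -addrA rpredD //.
  by rewrite -mulrBr idealpMl ?qrepr_pi.
by rewrite -mulrBl idealpMr ?qrepr_pi.
Qed.

Lemma qpiZ c f : qpi (c *: f) = qscale c (qpi f).
Proof. by apply/qpiP; rewrite -opprB rpredN -scalerBr idealpZ ?qrepr_pi. Qed.

Lemma qmulA : associative qmul.
Proof.
by move=> a b c; rewrite -[a]qreprK -[b]qreprK -[c]qreprK -!qpiM mulrA.
Qed.
Lemma qmul1 : left_id qone qmul.
Proof. by move=> a; rewrite -[a]qreprK -qpiM mul1r. Qed.
Lemma qmulr1 : right_id qone qmul.
Proof. by move=> a; rewrite -[a]qreprK -qpiM mulr1. Qed.
Lemma qmulDl : left_distributive qmul +%R.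
Proof.
by move=> a b c; rewrite -[a]qreprK -[b]qreprK -[c]qreprK -!(qpiM, qpiD) mulrDl.
Qed.
Lemma qmulDr : right_distributive qmul +%R.
Proof.
by move=> a b c; rewrite -[a]qreprK -[b]qreprK -[c]qreprK -!(qpiM, qpiD) mulrDr.
Qed.
HB.instance Definition _ := GRing.Zmodule_isPzRing.Build quotalg
  qmulA qmul1 qmulr1 qmulDl qmulDr.

Lemma qscaleA c d a : qscale c (qscale d a) = qscale (c * d) a.
Proof. by rewrite -[a]qreprK -!qpiZ scalerA. Qed.
Lemma qscale1 : left_id 1 qscale.
Proof. by move=> a; rewrite -[a]qreprK -qpiZ scale1r. Qed.
Lemma qscaleDr : right_distributive qscale +%R.
Proof.
by move=> c a b; rewrite -[a]qreprK -[b]qreprK -!(qpiZ, qpiD) scalerDr.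
Qed.
Lemma qscaleDl a : {morph qscale^~ a : c d / c + d}.
Proof. by move=> c d; rewrite -[a]qreprK -!(qpiZ, qpiD) scalerDl. Qed.
HB.instance Definition _ := GRing.Zmodule_isLmodule.Build R[i] quotalg
  qscaleA qscale1 qscaleDr qscaleDl.

End QuotientAlgebra.

Arguments qpi {R m} S f.
Arguments qrepr {R m S} a.
Arguments qstar {R m S} a.

Section NonExpanding.
Context (R : realType) (m : nat) (le : rel (letter m)).
Implicit Types (S : set (falg R m)) (f g : falg R m) (u v w : word m).

(* The result (f, g)_w for w = xyz, where lead f = xy and lead g = yz. *)
Definition composition f g (x z : word m) : falg R m :=
  leadc le g *: (f * wd R z) - leadc le f *: (wd R x * g).

Definition closed_under_compositions S : Prop :=
  [/\ ~ S 0,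
      forall f g, S f -> S g -> f != g -> ~~ infix (lead le f) (lead le g)
    & forall f g (x y z : word m), S f -> S g -> y != [::] ->
        lead le f = x ++ y -> lead le g = y ++ z ->
        exists (n : nat) (alpha : 'I_n -> R[i]) (a b : 'I_n -> word m)
               (h : 'I_n -> falg R m),
          (forall j, S (h j) /\
             wlt le (lead le (wd R (a j) * h j * wd R (b j))) (x ++ y ++ z)) /\
          composition f g x z =
            \sum_(j < n) alpha j *: (wd R (a j) * h j * wd R (b j))].

Definition symmetric_set S : Prop := @star R m @` ideal S = ideal S.

Definition BW S : set (word m) :=
  [set w | forall s, S s -> ~~ infix (lead le s) w].

(* The span of BW: words are linearly independent in F_*. *)
Definition spanBW S : set (falg R m) :=
  [set f | forall w, w \in msupp f -> BW S w].

(* R_S: for S closed under compositions, there is exactly one such g. *)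
Definition reduce S f : falg R m :=
  xget 0 [set g | spanBW S g /\ ideal S (f - g)].

Definition non_expanding S : Prop :=
  [/\ symmetric_set S, closed_under_compositions S
    & forall u v w, BW S u -> BW S v -> BW S w -> u != v ->
        (w ++ wstar w : word m) \in msupp (reduce S (wd R (u ++ wstar v))) ->
        wlt le w u \/ wlt le w v].

Definition strictly_non_expanding S : Prop :=
  non_expanding S /\ forall d, BW S d -> BW S (d ++ wstar d).

Definition enumeration S (phi : word m -> nat) : Prop :=
  set_bij (BW S)
    [set k | (0 < k)%N /\ (finite_set (BW S) -> (k <= #|` fset_set (BW S)|)%N)]
    phi /\
  forall u v, BW S u -> BW S v -> wlt le v u -> (phi v < phi u)%N.

(* If w = u u^* then u is the first half of w. *)
Definition opH f : falg R m :=
  \sum_(w <- msupp f)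
    (let u := take (size w)./2 w in
     if w == u ++ wstar u then f@_w *: wd R u else 0).

(* Only meaningful on spanBW. *)
Definition functT (phi : word m -> nat) (xi : nat -> R) f : R[i] :=
  \sum_(u <- msupp f) f@_u * (xi (phi u))%:C%C.

Definition xi_form_word S (phi : word m -> nat) (xi : nat -> R) u v : R[i] :=
  if u == v then (xi (phi u))%:C%C
  else functT phi xi (opH (reduce S (wd R (u ++ wstar v)))).

Definition xi_form S (phi : word m -> nat) (xi : nat -> R) f g : R[i] :=
  \sum_(u <- msupp f) \sum_(v <- msupp g)
    f@_u * (g@_v)^* * xi_form_word S phi xi u v.

Definition positive_definite (K : set (falg R m))
    (B : falg R m -> falg R m -> R[i]) : Prop :=
  forall f, K f -> f != 0 -> 0 < B f f.

(* The identification of A with spanBW; its inverse is the restriction of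
   [qpi S] to spanBW. *)
Definition normal_form S (a : quotalg S) : falg R m := reduce S (qrepr a).

Definition right_regular S (z : quotalg S) (f : falg R m) : falg R m :=
  normal_form (qpi S f * z).

Definition is_representation S (K : set (falg R m))
    (L : quotalg S -> falg R m -> falg R m) : Prop :=
  [/\ forall z, set_fun K K (L z),
      forall z c f g, K f -> K g -> L z (c *: f + g) = c *: L z f + L z g,
      forall c (z w : quotalg S) f, K f -> L (c *: z + w) f = c *: L z f + L w f,
      forall f, K f -> L 1 f = f
    & forall (z w : quotalg S) f, K f -> L (z * w) f = L w (L z f)].

Definition is_star_representation S (K : set (falg R m))
    (B : falg R m -> falg R m -> R[i])
    (L : quotalg S -> falg R m -> falg R m) : Prop :=
  is_representation K L /\
  forall z f g, K f -> K g -> B (L z f) g = B f (L (qstar z) g).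

Definition is_faithful S (K : set (falg R m))
    (L : quotalg S -> falg R m -> falg R m) : Prop :=
  forall z : quotalg S, z != 0 -> exists2 f, K f & L z f != 0.

End NonExpanding.

(* Main.v *)
Require Import Defs.
From mathcomp Require Import all_boot all_order all_algebra.
From mathcomp Require Import finmap monalg complex classical_sets reals.
From mathcomp Require Import boolp zify.

(** The point is that the form comes from a linear functional on the quotient
    algebra.  Put tau(f) = T(H(R_S(f))), a functional on F_* that vanishes on
    the ideal I.  For distinct basis words u and v the value of the form is
    tau(u star(v)) by definition; for u = v it is so as well, because u star(u)
    is again in BW, hence is its own normal form, and H sends it to u.  By
    sesquilinearity the form is tau(f star(g)) on the whole of K ([xi_formE]).
    The product of K differs from the product of F_* by elements of I, and I is
    stable under the involution, so that the equality
      (f z) star(g) = f star(g star(z))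
    in F_* gives the adjunction ([xi_form_adjoint]).  That the right
    multiplications compose as a representation is associativity modulo I, and
    faithfulness follows from the action on the normal form of 1, which is sent
    to the normal form of z.

    All of this rests on R_S being a linear projection onto K with kernel I,
    that is, on F_* being the direct sum of K and I.  This is the
    composition-diamond lemma, proved here from closure under compositions.
    Existence of normal forms ([normal_form_exists]) is rewriting of leading
    words along the well-founded order on words.  For uniqueness
    ([spanBW_ideal_eq0]), write an element of I as a combination of products
    a s b with s in S and consider the largest of the words a (lead s) b.  Two
    products with the same leading word agree, up to their leading
    coefficients, modulo products with smaller leading words
    ([overlap_below]): either the two occurrences of lead s and lead s' are
    disjoint, and s and s' can be exchanged for their tails, or they overlap,
    which is a composition, or one contains the other, which forces s = s' at
    the same place.  So a single product with that largest leading word is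
    enough ([lead_span_top]).  Since an element of K has coefficient zero at
    that word, this product drops out, and the bound can be lowered until the
    element is zero. *)

Set Implicit Arguments.
Unset Strict Implicit.
Unset Printing Implicit Defensive.

Import Order.TTheory GRing.Theory Num.Theory.
Local Open Scope classical_set_scope.
Local Open Scope ring_scope.

(** * The degree-lexicographic order on words *)

Section WordOrderTheory.
Context (m : nat) (le : rel (letter m)) (le_lin : linear_order le).
Implicit Types (u v w a b : word m).

Lemma lex_lt_irr : irreflexive (lex_lt le).
Proof. by elim=> //= x u IH; rewrite eqxx /= IH. Qed.

Lemma lex_lt_trans : transitive (lex_lt le).
Proof.
have [_ anti tr _] := le_lin.
elim=> [|y v IH] [|x u] [|z w] //=.
case/orP=> [/andP[xy lexy]|/andP[/eqP-> uv]].
  case/orP=> [/andP[yz leyz]|/andP[/eqP<- _]]; last by rewrite xy lexy.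
  rewrite (tr _ _ _ lexy leyz) andbT; case: eqP => //= xz.
  by case/eqP: xy; apply: anti; rewrite lexy xz.
case/orP=> [->//|/andP[-> vw]].
by rewrite (IH _ _ uv vw) orbT.
Qed.

Lemma lex_lt_total u v : u != v -> lex_lt le u v || lex_lt le v u.
Proof.
have [_ _ _ tot] := le_lin.
elim: u v => [|x u IH] [|y v] //=.
rewrite eqseq_cons; have [->|xy] /= := eqVneq x y; first exact: IH.
by rewrite ?orbF => _; exact: tot.
Qed.

Lemma lex_lt_catl a u v : lex_lt le (a ++ u) (a ++ v) = lex_lt le u v.
Proof. by elim: a => //= x a ->; rewrite eqxx. Qed.

Lemma lex_lt_catr u v b :
  size u = size v -> lex_lt le u v -> lex_lt le (u ++ b) (v ++ b).
Proof.
elim: u v => [|x u IH] [|y v] //= [suv].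
by case/orP=> [->//|/andP[-> uv]]; rewrite IH ?orbT.
Qed.

Lemma wlt_irr : irreflexive (wlt le).
Proof. by move=> u; rewrite /wlt ltnn eqxx lex_lt_irr. Qed.

Lemma wlt_trans : transitive (wlt le).
Proof.
move=> v u w; rewrite /wlt.
case/orP=> [suv|/andP[/eqP suv uv]].
  by case/orP=> [svw|/andP[/eqP<- _]]; rewrite ?suv ?(ltn_trans suv svw).
case/orP=> [svw|/andP[/eqP svw vw]]; first by rewrite suv svw.
by rewrite suv svw eqxx (lex_lt_trans uv vw) orbT.
Qed.

Lemma wlt_total u v : u != v -> wlt le u v || wlt le v u.
Proof.
move=> uv; rewrite /wlt; case: ltngtP => //= _; exact: lex_lt_total.
Qed.

Lemma wlt_cat a b u v : wlt le u v -> wlt le (a ++ u ++ b) (a ++ v ++ b).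
Proof.
rewrite /wlt !size_cat ltn_add2l eqn_add2l ltn_add2r eqn_add2r lex_lt_catl.
case/orP=> [->//|/andP[/eqP suv uv]].
by rewrite suv eqxx lex_lt_catr ?orbT.
Qed.

Lemma wlt_catr b u v : wlt le u v -> wlt le (u ++ b) (v ++ b).
Proof. exact: (@wlt_cat [::] b u v). Qed.

Lemma wlt_catl a u v : wlt le u v -> wlt le (a ++ u) (a ++ v).
Proof. by move/(wlt_cat a [::]); rewrite !cats0. Qed.

(** There are finitely many words of each length, so that a descending chain
    is controlled by its lengths and, at constant length, by the number of
    lexicographically smaller words. *)
Lemma wlt_wf : well_founded (wlt le).
Proof.
suff acc n w : size w = n -> Acc (wlt le) w by move=> w; apply: (acc _ _ erefl).
elim/ltn_ind: n w => n IHn w sw.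
pose smaller (v : word m) := #|[pred t : n.-tuple (letter m) | lex_lt le t v]|.
have [k lek] := ubnP (smaller w); elim: k w lek sw => [w|k IHk w lek sw].
  by rewrite ltn0.
constructor=> v /orP[svw|/andP[/eqP svw vw]].
  by apply: IHn (erefl _); rewrite -sw.
rewrite sw in svw; apply: (IHk _ _ svw).
rewrite -ltnS; apply: leq_trans lek; apply: proper_card; apply/properP; split.
  by apply/fintype.subsetP=> t; rewrite !inE => /lex_lt_trans; apply.
exists (@Tuple n _ v (introT eqP svw)); first by rewrite inE.
by rewrite !inE lex_lt_irr.
Qed.

Definition wle u v : bool := (u == v) || wlt le u v.

Lemma wlexx u : wle u u. Proof. by rewrite /wle eqxx. Qed.

Lemma wltW u v : wlt le u v -> wle u v.
Proof. by rewrite /wle orbC => ->. Qed.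

Lemma wle_lt_trans v u w : wle u v -> wlt le v w -> wlt le u w.
Proof. by case/orP=> [/eqP->//|]; exact: wlt_trans. Qed.

Lemma wlt_le_trans v u w : wlt le u v -> wle v w -> wlt le u w.
Proof. by move=> uv /orP[/eqP<-//|]; exact: wlt_trans. Qed.

Lemma wle_trans : transitive wle.
Proof. by move=> v u w uv /orP[/eqP<-//|] /(wle_lt_trans uv) /wltW. Qed.

Lemma wle_anti : antisymmetric wle.
Proof.
move=> u v /andP[/orP[/eqP//|uv]] /(wlt_le_trans uv).
by rewrite wlt_irr.
Qed.

Lemma wle_cat a b u v : wle u v -> wle (a ++ u ++ b) (a ++ v ++ b).
Proof.
by case/orP=> [/eqP->|/(wlt_cat a b)/wltW//]; exact: wlexx.
Qed.

Lemma wle_wmaxl u v : wle u (wmax le u v).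
Proof. by rewrite /wmax; case: ifP => [/wltW|_] //; rewrite wlexx. Qed.

Lemma wle_wmaxr u v : wle v (wmax le u v).
Proof.
rewrite /wmax; case: ifP => [_|uv]; first exact: wlexx.
by rewrite /wle; case: eqVneq => //= /wlt_total; rewrite uv orbF.
Qed.

Lemma wle_bigwmax (s : seq (word m)) w :
  w \in s -> wle w (\big[wmax le/[::]]_(v <- s) v).
Proof.
elim: s => // v s IH; rewrite big_cons inE => /orP[/eqP->|/IH ws].
  exact: wle_wmaxl.
exact: wle_trans ws (wle_wmaxr _ _).
Qed.

Lemma bigwmax_mem (s : seq (word m)) :
  s != [::] -> \big[wmax le/[::]]_(v <- s) v \in s.
Proof.
elim: s => // v [_ _|u s IH _]; last first.
  by rewrite big_cons {1}/wmax; case: ifP => _; rewrite inE ?eqxx // IH ?orbT.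
by rewrite big_cons big_nil inE /wmax; case: (v).
Qed.

Section LeadingWord.
Context (R : realType).
Implicit Types (f : falg R m).

Lemma lead_max f w : w \in msupp f -> wle w (lead le f).
Proof. exact: wle_bigwmax. Qed.

Lemma lead_supp f : f != 0 -> lead le f \in msupp f.
Proof.
rewrite -msupp_eq0 => f0; apply: bigwmax_mem.
apply: contra f0 => /eqP f0; apply/eqP/fsetP => w.
by rewrite inE -[LHS]/(w \in enum_fset _) f0.
Qed.

Lemma leadP f w :
  w \in msupp f -> (forall v, v \in msupp f -> wle v w) -> lead le f = w.
Proof.
move=> wf wmax; apply: wle_anti; rewrite lead_max // wmax // lead_supp //.
by apply: contraTneq wf => ->; rewrite msupp0 inE.
Qed.

Lemma leadc_neq0 f : f != 0 -> leadc le f != 0.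
Proof. by move=> f0; rewrite /leadc mcoeff_neq0 lead_supp. Qed.

End LeadingWord.
End WordOrderTheory.

(** * Linear algebra over words *)

Section FreeAlgebra.
Context (R : realType) (m : nat).
Implicit Types (f g h : falg R m) (u v w a b : word m) (c : R[i]).

Lemma malgU_scale c w : << c *g w >> = c *: wd R w.
Proof. by apply/malgP=> k; rewrite mcoeffZ !mcoeffU mulrnAr mulr1. Qed.

Lemma falg_ind (P : falg R m -> Prop) :
  P 0 -> (forall c w f, P f -> P (c *: wd R w + f)) -> forall f, P f.
Proof.
move=> P0 Padd f; rewrite [f]monalgE.
elim: (enum_fset (msupp f)) => [|w s IH]; first by rewrite big_nil.
by rewrite big_cons malgU_scale; apply: Padd.
Qed.

Lemma mcoeff_lin c f g w : (c *: f + g)@_w = c * f@_w + g@_w.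
Proof. by rewrite mcoeffD mcoeffZ. Qed.

(** Scalars are central although F_* is not commutative: only the scalar ring
    has to be. *)
Lemma falg_scalerAr c f g : f * (c *: g) = c *: (f * g).
Proof.
apply/malgP=> k; rewrite [LHS](mcoeffMlw k (fsubset_refl _) (msuppZ_le c g)).
rewrite mcoeffZ [(f * g)@_k]mcoeffMl mulr_sumr.
apply: eq_bigr => u _; rewrite mulr_sumr; apply: eq_bigr => v _.
by rewrite mcoeffZ mulrCA mulrnAr.
Qed.

Lemma wdM u v : wd R u * wd R v = wd R (u ++ v).
Proof. by rewrite malgM_def fgmulUU mul1r. Qed.

Lemma wd_nil : wd R [::] = 1 :> falg R m. Proof. by []. Qed.

Lemma mcoeff_wd u w : (wd R u)@_w = (u == w)%:R.
Proof. exact: mcoeffU1. Qed.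

Lemma msupp_wd u w : (u \in msupp (wd R w)) = (u == w).
Proof. by rewrite msuppU1 in_fset1. Qed.

Lemma sandwich_lin a b c f g : wd R a * (c *: f + g) * wd R b =
  c *: (wd R a * f * wd R b) + wd R a * g * wd R b.
Proof. by rewrite mulrDr mulrDl falg_scalerAr -scalerAl. Qed.

Lemma sandwich_wd a b w : wd R a * wd R w * wd R b = wd R (a ++ w ++ b).
Proof. by rewrite wdM wdM catA. Qed.

Lemma sandwich_lin_wd a b c w f : wd R a * (c *: wd R w + f) * wd R b =
  c *: wd R (a ++ w ++ b) + wd R a * f * wd R b.
Proof.
transitivity (c *: (wd R a * wd R w * wd R b) + wd R a * f * wd R b).
  exact: sandwich_lin.
by apply: (congr1 (fun x => c *: x + _)); exact: sandwich_wd.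
Qed.

Lemma sandwich_sandwich a b u v f :
  wd R a * (wd R u * f * wd R v) * wd R b =
  wd R (a ++ u) * f * wd R (v ++ b).
Proof.
rewrite -(wdM a) -(wdM v).
suff assoc (A : nzRingType) (x y z p q : A) :
    x * (y * z * p) * q = (x * y) * z * (p * q) by exact: assoc.
by rewrite !mulrA.
Qed.

Lemma sandwich_lin_sandwich a b c u v f g :
  wd R a * (c *: (wd R u * f * wd R v) + g) * wd R b =
  c *: (wd R (a ++ u) * f * wd R (v ++ b)) + wd R a * g * wd R b.
Proof.
transitivity (c *: (wd R a * (wd R u * f * wd R v) * wd R b) +
    wd R a * g * wd R b).
  exact: sandwich_lin.
by apply: (congr1 (fun x => c *: x + _)); exact: sandwich_sandwich.
Qed.

Lemma eq_cat_sandwich a b u v : (a ++ u ++ b == a ++ v ++ b) = (u == v).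
Proof.
rewrite eqseq_cat // eqxx /=; apply/eqP/eqP => [uv|-> //].
have suv : size u = size v.
  by move: (congr1 size uv); rewrite !size_cat => /addIn.
by move/eqP: uv; rewrite eqseq_cat // eqxx andbT => /eqP.
Qed.

Lemma mcoeff_sandwich a b f w : (wd R a * f * wd R b)@_(a ++ w ++ b) = f@_w.
Proof.
elim/falg_ind: f => [|c u f IH]; first by rewrite mulr0 mul0r !mcoeff0.
rewrite [in LHS]sandwich_lin_wd [LHS]mcoeff_lin [RHS]mcoeff_lin.
congr (_ * _ + _); last exact: IH.
rewrite !mcoeff_wd; by rewrite eq_cat_sandwich.
Qed.

Lemma msupp_sandwich a b f w : w \in msupp (wd R a * f * wd R b) ->
  exists2 v, v \in msupp f & w = a ++ v ++ b.
Proof.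
case/msuppM_le=> x [y [/msuppM_le[u [v []]]]].
by rewrite !msupp_wd => /eqP-> vf -> /eqP-> ->; exists v; rewrite ?catA.
Qed.

(** A sum over the support is additive although the support is not: terms added
    outside the support vanish.  The involution, the operator H and the
    functional T are all of this kind; the summand depends additively, but for
    the involution not linearly, on the coefficient. *)
Section SupportSum.
Context (V : zmodType) (F : word m -> R[i] -> V).
Hypothesis FD : forall w, {morph F w : c d / c + d}.

Let F0 w : F w 0 = 0.
Proof. by apply: (addIr (F w 0)); rewrite -FD !add0r. Qed.

Lemma supp_sumEw (d : {fset word m}) f : (msupp f `<=` d)%fset ->
  \sum_(w <- msupp f) F w f@_w = \sum_(w <- d) F w f@_w.
Proof.
by move=> fd; apply: big_fset_incl => // w _ /mcoeff_outdom->; exact: F0.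
Qed.

Lemma supp_sumD f g : \sum_(w <- msupp (f + g)) F w (f + g)@_w =
  \sum_(w <- msupp f) F w f@_w + \sum_(w <- msupp g) F w g@_w.
Proof.
rewrite (supp_sumEw (msuppD_le f g)) (supp_sumEw (fsubsetUl _ (msupp g))).
rewrite (supp_sumEw (fsubsetUr (msupp f) _)) -big_split.
by apply: eq_bigr => w _; rewrite mcoeffD FD.
Qed.

Lemma supp_sumZ c (s : V -> V) f : s 0 = 0 -> {morph s : x y / x + y} ->
  (forall w d, F w (c * d) = s (F w d)) ->
  \sum_(w <- msupp (c *: f)) F w (c *: f)@_w = s (\sum_(w <- msupp f) F w f@_w).
Proof.
move=> s0 sD sF; rewrite (supp_sumEw (msuppZ_le c f)) (big_morph s sD s0).
by apply: eq_bigr => w _; rewrite mcoeffZ.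
Qed.

Lemma supp_sumU c w :
  \sum_(u <- msupp (c *: wd R w)) F u (c *: wd R w)@_u = F w c.
Proof.
rewrite -malgU_scale (supp_sumEw msuppU_le) big_seq_fset1.
by rewrite mcoeffU eqxx.
Qed.

Lemma supp_sum0 : \sum_(w <- msupp (0 : falg R m)) F w (0 : falg R m)@_w = 0.
Proof. by rewrite msupp0 big_seq_fset0. Qed.

End SupportSum.

End FreeAlgebra.

Section LeadSandwich.
Context (R : realType) (m : nat).
Context (le : rel (letter m)) (le_lin : linear_order le).
Implicit Types (f : falg R m) (w a b : word m).

Lemma lead_sandwich a b f : f != 0 ->
  lead le (wd R a * f * wd R b) = a ++ lead le f ++ b.
Proof.
move=> f0; apply: leadP => // [|w /msupp_sandwich[v vf ->]].
  by rewrite -mcoeff_neq0 mcoeff_sandwich mcoeff_neq0 lead_supp.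
by apply: wle_cat => //; exact: lead_max.
Qed.

End LeadSandwich.

(** * Composition-diamond lemma *)

Section Ideal.
Context (R : realType) (m : nat) (S : set (falg R m)).
Implicit Types (f g h : falg R m) (c : R[i]).

Lemma ideal0 : ideal S 0. Proof. by have [] := ideal_is_ideal S. Qed.

Lemma idealD f g : ideal S f -> ideal S g -> ideal S (f + g).
Proof. by have [_ + _ _] := ideal_is_ideal S; apply. Qed.

Lemma ideal_lmul f g : ideal S g -> ideal S (f * g).
Proof. by have [_ _ + _] := ideal_is_ideal S; apply. Qed.

Lemma ideal_rmul f g : ideal S f -> ideal S (f * g).
Proof. by have [_ _ _ +] := ideal_is_ideal S; apply. Qed.

Lemma idealZ c f : ideal S f -> ideal S (c *: f).
Proof. by move=> If; apply/asboolP/idealpZ/asboolP. Qed.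

Lemma idealB f g : ideal S f -> ideal S g -> ideal S (f - g).
Proof.
by move=> If Ig; apply: idealD => //; rewrite -scaleN1r; apply: idealZ.
Qed.

Lemma ideal_trans g f h : ideal S (f - g) -> ideal S (g - h) -> ideal S (f - h).
Proof. by move=> Ifg /(idealD Ifg); rewrite addrA subrK. Qed.

Lemma ideal_qrepr f : ideal S (qrepr (qpi S f) - f).
Proof. by apply/asboolP; exact: qrepr_pi. Qed.

End Ideal.

Section LeadSpan.
Context (R : realType) (m : nat) (le : rel (letter m)) (S : set (falg R m)).
Implicit Types (f g s : falg R m) (u v w a b : word m) (c : R[i]).
Implicit Types (P Q : word m -> Prop).

(** Being in [lead_span P] is a property of a presentation as a combination of
    products a s b, and not only of the value: the words bounded by P are
    those of the summands, which may be larger than the leading word of the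
    sum. *)
Inductive lead_span P : falg R m -> Prop :=
| lead_span0 : lead_span P 0
| lead_span_cons c a s b f : S s -> P (a ++ lead le s ++ b) ->
    lead_span P f -> lead_span P (c *: (wd R a * s * wd R b) + f).

Lemma lead_span_sub P Q f :
  (forall w, P w -> Q w) -> lead_span P f -> lead_span Q f.
Proof.
move=> PQ; elim=> [|c a s b g Ss /PQ Qs _ IH]; first exact: lead_span0.
exact: lead_span_cons.
Qed.

Lemma lead_spanD P f g : lead_span P f -> lead_span P g -> lead_span P (f + g).
Proof.
move=> Pf Pg; elim: Pf => [|c a s b h Ss Ps _ IH]; first by rewrite add0r.
by rewrite -addrA; apply: lead_span_cons.
Qed.

Lemma lead_spanZ P c f : lead_span P f -> lead_span P (c *: f).
Proof.
elim=> [|d a s b g Ss Ps _ IH]; first by rewrite scaler0; exact: lead_span0.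
by rewrite scalerDr scalerA; apply: lead_span_cons.
Qed.

Lemma lead_spanB P f g : lead_span P f -> lead_span P g -> lead_span P (f - g).
Proof. by move=> Pf Pg; rewrite -scaleN1r; apply/lead_spanD/lead_spanZ. Qed.

Lemma lead_span_sum P (I : eqType) (r : seq I) (F : I -> falg R m) :
  (forall i, i \in r -> lead_span P (F i)) -> lead_span P (\sum_(i <- r) F i).
Proof.
move=> PF; rewrite big_seq; elim/big_ind: _ => //; first exact: lead_span0.
exact: lead_spanD.
Qed.

Lemma lead_span_gen P a s b :
  S s -> P (a ++ lead le s ++ b) -> lead_span P (wd R a * s * wd R b).
Proof.
move=> Ss Ps; rewrite -[X in lead_span _ X]addr0 -[X in X + 0]scale1r.
by apply: lead_span_cons => //; exact: lead_span0.
Qed.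

Lemma lead_span_sandwich P Q a b f : (forall w, P w -> Q (a ++ w ++ b)) ->
  lead_span P f -> lead_span Q (wd R a * f * wd R b).
Proof.
move=> PQ; elim=> [|c u s v g Ss Ps _ IH].
  by rewrite mulr0 mul0r; exact: lead_span0.
rewrite sandwich_lin_sandwich; apply: lead_span_cons => //.
by move/PQ: Ps; rewrite -!catA.
Qed.

Lemma lead_spanMr P a s f : S s ->
  (forall u, u \in msupp f -> P (a ++ lead le s ++ u)) ->
  lead_span P (wd R a * s * f).
Proof.
move=> Ss Pf; rewrite [f]monalgE mulr_sumr; apply: lead_span_sum => u uf.
rewrite malgU_scale falg_scalerAr; apply: lead_spanZ.
by apply: lead_span_gen => //; exact: Pf.
Qed.

Lemma lead_spanMl P b s f : S s ->
  (forall u, u \in msupp f -> P (u ++ lead le s ++ b)) ->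
  lead_span P (f * s * wd R b).
Proof.
move=> Ss Pf; rewrite -mulrA [f]monalgE mulr_suml.
apply: lead_span_sum => u uf.
rewrite malgU_scale -scalerAl mulrA; apply: lead_spanZ.
by apply: lead_span_gen => //; exact: Pf.
Qed.

Lemma ideal_lead_span f : ideal S f -> lead_span (fun=> True) f.
Proof.
apply: smallest_sub => [|s Ss]; last first.
  by rewrite -[s]mul1r -[1 * s]mulr1; apply: lead_span_gen.
split=> [|f1 f2|a g|a g]; first exact: lead_span0.
- exact: lead_spanD.
- move=> Pg; rewrite [a]monalgE mulr_suml; apply: lead_span_sum => u _.
  rewrite malgU_scale -scalerAl -[_ * g]mulr1; apply: lead_spanZ.
  exact: lead_span_sandwich Pg.
- move=> Pg; rewrite [a]monalgE mulr_sumr; apply: lead_span_sum => u _.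
  rewrite malgU_scale falg_scalerAr -[g]mul1r; apply: lead_spanZ.
  exact: lead_span_sandwich Pg.
Qed.

End LeadSpan.

Section CompositionDiamond.
Context (R : realType) (m : nat).
Context (le : rel (letter m)) (le_lin : linear_order le).
Context (S : set (falg R m)).
Implicit Types (f g s : falg R m) (u v w a b : word m) (c : R[i]).

Local Notation below w := (lead_span le S (fun v => wlt le v w)).

Definition tail f : falg R m := f - leadc le f *: wd R (lead le f).

Lemma lead_tail f : f = leadc le f *: wd R (lead le f) + tail f.
Proof. by rewrite addrC subrK. Qed.

Lemma tail_lt f w : w \in msupp (tail f) -> wlt le w (lead le f).
Proof.
move=> wf; have wl : w != lead le f.
  apply: contraTneq wf => ->; rewrite -mcoeff_neq0 mcoeffB mcoeffZ mcoeff_wd.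
  by rewrite eqxx mulr1 subrr eqxx.
suff: w \in msupp f.
  by move/(lead_max le_lin)/orP=> [/eqP eq_wl|//]; case/eqP: wl.
move: wf; rewrite -!mcoeff_neq0 mcoeffB mcoeffZ mcoeff_wd.
rewrite [lead le f == w]eq_sym (negPf wl).
by rewrite mulr0 subr0.
Qed.

Hypothesis Scomp : closed_under_compositions le S.

Lemma closed_neq0 s : S s -> s != 0.
Proof. by have [S0 _ _] := Scomp; apply: contraPneq => ->. Qed.

Lemma eq_cat_split (T : eqType) (u b d r : seq T) : u ++ b = d ++ r ->
  (exists e, d = u ++ e /\ b = e ++ r) \/
  (exists2 e, e != [::] & u = d ++ e /\ r = e ++ b).
Proof.
elim: u d => [|x u IH] [|y d] /=; try by move=> ->; left; exists [::].
- by move=> ->; left; exists (y :: d).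
- by move=> <-; right; exists (x :: u).
move=> [<- /IH[[e [-> ->]]|[e e0 [-> ->]]]]; [left|right]; by exists e.
Qed.

(** The left-hand side is the difference of two products with the same leading
    word, e and c being the leading coefficients and l and l' the leading words
    of s and s'; on the right both terms involve a tail, s - e l or
    s' - c l'. *)
Lemma overlap_expand (C : nzRingType) (A : lalgType C)
    (scalerAr : forall (c : C) (x y : A), x * (c *: y) = c *: (x * y))
    (c e : C) (s s' d b l l' : A) :
  c *: (s * (d * l' * b)) - e *: (l * d * s' * b) =
  (s - e *: l) * d * s' * b - 1 * s * (d * (s' - c *: l') * b).
Proof.
rewrite mul1r !mulrBl mulrBr mulrBl mulrBr -!scalerAl !scalerAr -!scalerAl.
by rewrite !scalerAr !mulrA opprB [RHS]addrC addrA subrK.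
Qed.

Lemma composition_expand (C : nzRingType) (A : lalgType C)
    (c e : C) (s s' x z b : A) :
  c *: (s * (z * b)) - e *: (x * s' * b) =
  1 * (c *: (s * z) - e *: (x * s')) * b.
Proof. by rewrite mul1r mulrBl -!scalerAl !mulrA. Qed.

(** The case where the occurrence of lead s starts the word.  The remaining
    part a' of the word before lead s' either contains lead s, or ends inside
    it, in which case lead s' ends either inside lead s or beyond it. *)
Lemma left_overlap_below s s' b a' b' : S s -> S s' ->
  lead le s ++ b = a' ++ lead le s' ++ b' ->
  below (lead le s ++ b)
    (leadc le s' *: (s * wd R b) - leadc le s *: (wd R a' * s' * wd R b')).
Proof.
move=> Ss Ss' eqw; rewrite eqw; case: (eq_cat_split eqw).
  move=> [d [-> ->]].
  (* Disjoint occurrences, the word being (lead s) d (lead s') b': with t and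
     t' the tails, the two scaled products are s d s' b' minus s d t' b' and
     s d s' b' minus t d s' b'. *)
  have -> : leadc le s' *: (s * wd R (d ++ lead le s' ++ b')) -
      leadc le s *: (wd R (lead le s ++ d) * s' * wd R b') =
      (tail s * wd R d) * s' * wd R b' -
      wd R [::] * s * (wd R d * tail s' * wd R b').
    rewrite -(sandwich_wd R d b' (lead le s')) -(wdM R (lead le s) d) wd_nil.
    exact: (overlap_expand (@falg_scalerAr R m)).
  apply: lead_spanB.
    apply: lead_spanMl => // u.
    rewrite -[tail s]mul1r -wd_nil => /msupp_sandwich[v /tail_lt vs ->] /=.
    by rewrite -!catA; apply: wlt_catr.
  apply: lead_spanMr => // u /msupp_sandwich[v /tail_lt vs ->] /=.
  by rewrite -catA; apply: wlt_catl; apply: wlt_catl; apply: wlt_catr.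
move=> [e e0 [ls eb]]; case: (eq_cat_split (esym eb)).
  (* A proper overlap e: a composition, multiplied on the right by b'. *)
  move=> [d [ls' ->]].
  have [_ _ comp] := Scomp.
  have [n [alpha [p [q [h [hlt comp_eq]]]]]] := comp _ _ _ _ _ Ss Ss' e0 ls ls'.
  rewrite -wdM.
  suff -> : leadc le s' *: (s * (wd R d * wd R b')) -
       leadc le s *: (wd R a' * s' * wd R b') =
       wd R [::] * composition le s s' a' d * wd R b'.
    apply: (lead_span_sandwich (P := fun v => wlt le v (a' ++ e ++ d))).
      by move=> w /(wlt_catr b'); rewrite ls' -!catA.
    rewrite comp_eq; apply: lead_span_sum => i _; apply: lead_spanZ.
    have [Sh] := hlt i; rewrite lead_sandwich ?closed_neq0 // => lt_i.
    exact: lead_span_gen.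
  exact: composition_expand.
(* Here lead s = a' (lead s') d with d nonempty; leading words of distinct
   relations are not subwords of each other, and s' = s contradicts the
   lengths. *)
move=> [d d0 [ed _]]; exfalso.
have [_ irr _] := Scomp.
have eqs : s' = s.
  apply/eqP; apply: contraT => /(irr _ _ Ss' Ss).
  by rewrite ls ed infix_catl ?infix_catr ?infix_refl.
move: (congr1 size ls); rewrite ed eqs !size_cat.
by case: d d0 {ed} => //= x d _; lia.
Qed.

Lemma sandwich_expand (C : nzRingType) (A : lalgType C)
    (scalerAr : forall (c : C) (x y : A), x * (c *: y) = c *: (x * y))
    (c e : C) (s s' a b d b' : A) :
  c *: (a * s * b) - e *: (a * d * s' * b') =
  a * (c *: (s * b) - e *: (d * s' * b')) * 1.
Proof. by rewrite mulr1 mulrBr !scalerAr !mulrA. Qed.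

Lemma overlap_below w s s' a b a' b' : S s -> S s' ->
  w = a ++ lead le s ++ b -> w = a' ++ lead le s' ++ b' ->
  below w (leadc le s' *: (wd R a * s * wd R b) -
           leadc le s *: (wd R a' * s' * wd R b')).
Proof.
wlog le_a : s s' a b a' b' / (size a <= size a')%N.
  move=> IH Ss Ss' ws ws'; case: (leqP (size a) (size a')) => [|/ltnW] le_a.
    exact: IH.
  by rewrite -opprB -scaleN1r; apply: lead_spanZ; exact: IH.
move=> Ss Ss' -> eqw; case: (eq_cat_split eqw) => [[d [a'E eqd]]|]; last first.
  move=> [e e0 [aE _]]; case: e e0 aE le_a => // x e _ ->.
  by rewrite size_cat /=; lia.
have -> : leadc le s' *: (wd R a * s * wd R b) -
    leadc le s *: (wd R a' * s' * wd R b') =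
    wd R a * (leadc le s' *: (s * wd R b) -
              leadc le s *: (wd R d * s' * wd R b')) * wd R [::].
  by rewrite a'E -wdM; exact: (sandwich_expand (@falg_scalerAr R m)).
apply: lead_span_sandwich (left_overlap_below Ss Ss' eqd) => v.
by rewrite cats0; exact: wlt_catl.
Qed.

Lemma below_coeff w f : below w f -> f@_w = 0.
Proof.
elim=> [|c a s b g Ss lt_w _ IH]; first exact: mcoeff0.
rewrite mcoeffD mcoeffZ IH addr0 mcoeff_outdom ?mulr0 //.
apply: contraTN lt_w => /(lead_max le_lin).
rewrite lead_sandwich ?closed_neq0 // => le_w; apply/negP.
move=> /(wle_lt_trans le_lin le_w).
by rewrite wlt_irr.
Qed.

Lemma pivot_expand (C : fieldType) (V : lmodType C) (c d e k : C)
    (x y z : V) : k != 0 ->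
  c *: x + z - (d + c * (e / k)) *: y =
  (c / k) *: (k *: x - e *: y) + (z - d *: y).
Proof.
move=> k0; rewrite scalerBr !scalerA divfK // scalerDl opprD.
by rewrite [- (d *: y) - _]addrC addrACA mulrA mulrAC.
Qed.

(** All summands with leading word w are proportional to any one of them modulo
    smaller words, hence can be collected into a single summand. *)
Lemma lead_span_top w f : lead_span le S (fun v => wle le v w) f ->
  below w f \/ exists a s b c, [/\ S s, w = a ++ lead le s ++ b &
    below w (f - c *: (wd R a * s * wd R b))].
Proof.
elim=> [|c a s b g Ss /orP[/eqP/esym ws|lt_w] _].
    by left; exact: lead_span0.
  move=> [gw|[a' [s' [b' [c' [Ss' ws' gw]]]]]]; right.
    exists a, s, b, c; split; [exact: Ss|exact: ws|].
    by rewrite addrAC subrr add0r.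
  exists a', s', b', (c' + c * (leadc le s / leadc le s')).
  split; [exact: Ss'|exact: ws'|].
  rewrite (pivot_expand _ _ _ _ _ _ (leadc_neq0 le (closed_neq0 Ss'))).
  by apply: lead_spanD gw; apply: lead_spanZ; exact: overlap_below.
move=> [gw|[a' [s' [b' [c' [Ss' ws' gw]]]]]].
  by left; apply: lead_span_cons.
right; exists a', s', b', c'; split; [exact: Ss'|exact: ws'|].
by rewrite -addrA; apply: lead_span_cons.
Qed.

(** If a summand has leading word w, then w is not in BW and has coefficient
    zero in f; after collecting, w comes from a single summand, whose
    coefficient is therefore zero. *)
Lemma spanBW_below w f : spanBW le S f ->
  lead_span le S (fun v => wle le v w) f -> below w f.
Proof.
move=> Kf /lead_span_top[//|[a [s [b [c [Ss ws fw]]]]]].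
suff c0 : c = 0 by move: fw; rewrite c0 scale0r subr0.
have fw0 : f@_w = 0.
  apply: mcoeff_outdom; apply/negP => /Kf /(_ s Ss).
  by rewrite ws infix_catl ?infix_catr ?infix_refl.
move/eqP: (below_coeff fw); rewrite mcoeffB fw0 sub0r oppr_eq0 mcoeffZ.
rewrite {1}ws mcoeff_sandwich mulf_eq0 => /orP[/eqP//|].
by rewrite (negPf (leadc_neq0 le (closed_neq0 Ss))).
Qed.

(** A presentation is finite, so that the largest leading word of its summands
    is attained: this is what turns a strict bound into a weak bound by a
    smaller word. *)
Lemma lead_span_bound (P : word m -> Prop) f : lead_span le S P f ->
  f = 0 \/ exists2 w, P w & lead_span le S (fun v => wle le v w) f.
Proof.
elim=> [|c a s b g Ss Pw _ [->|[w Pw' gw]]]; first by left.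
  right; exists (a ++ lead le s ++ b) => //.
  by apply: lead_span_cons => //; [exact: wlexx|exact: lead_span0].
right; exists (wmax le (a ++ lead le s ++ b) w).
  by rewrite /wmax; case: ifP.
apply: lead_span_cons => //; first exact: wle_wmaxl.
by apply: lead_span_sub gw => v /(wle_trans le_lin); apply; exact: wle_wmaxr.
Qed.

(** Descent on the bound of a presentation. *)
Theorem spanBW_ideal_eq0 f : spanBW le S f -> ideal S f -> f = 0.
Proof.
move=> Kf /(ideal_lead_span le)/lead_span_bound[//|[w _]].
elim/(well_founded_ind (wlt_wf le_lin)): w => w IH /(spanBW_below Kf).
by move/lead_span_bound=> [//|[v vw /IH]]; exact.
Qed.

Lemma spanBW0 : spanBW le S 0.
Proof. by move=> w; rewrite msupp0 inE. Qed.

Lemma spanBWD f g : spanBW le S f -> spanBW le S g -> spanBW le S (f + g).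
Proof.
move=> Kf Kg w /(fsubsetP (msuppD_le f g)); rewrite in_fsetU => /orP[].
  exact: Kf.
exact: Kg.
Qed.

Lemma spanBWZ c f : spanBW le S f -> spanBW le S (c *: f).
Proof. by move=> Kf w /(fsubsetP (msuppZ_le c f)) /Kf. Qed.

Lemma solve_expand (C : fieldType) (V : lmodType C) (k : C) (x y z g : V) :
  k != 0 -> x = k *: y + z ->
  y - (- k^-1 *: g) = k^-1 *: (x + -1 *: (z - g)).
Proof.
move=> k0 ->; rewrite scaleN1r opprB scaleNr opprK addrACA subrr addr0.
by rewrite scalerDr scalerA mulVf // scale1r.
Qed.

(** A word outside BW is congruent to a combination of smaller words, obtained
    by replacing a leading word inside it by the tail of the corresponding
    relation. *)
Lemma normal_form_exists f : exists g, spanBW le S g /\ ideal S (f - g).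
Proof.
pose reducible h := exists g, spanBW le S g /\ ideal S (h - g).
have red0 : reducible 0.
  by exists 0; rewrite subr0; split; [exact: spanBW0|exact: ideal0].
have redD c h h' : reducible h -> reducible h' -> reducible (c *: h + h').
  move=> [g [Kg Ig]] [g' [Kg' Ig']]; exists (c *: g + g'); split.
    by apply: spanBWD => //; exact: spanBWZ.
  by rewrite opprD addrACA -scalerBr; apply: idealD => //; exact: idealZ.
elim/falg_ind: f => // c w f; apply: (redD).
elim/(well_founded_ind (wlt_wf le_lin)): w => {}w IH.
case: (pselect (BW le S w)) => [BWw|/existsNP[s /not_implyP[Ss]]].
  exists (wd R w); rewrite subrr; split=> [v|].
    by rewrite msupp_wd => /eqP->.
  exact: ideal0.
move=> /negP; rewrite negbK => /infixP[a [b wE]].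
have lc0 : leadc le s != 0 by rewrite leadc_neq0 ?closed_neq0.
have asbE : wd R a * s * wd R b =
    leadc le s *: wd R w + wd R a * tail s * wd R b.
  rewrite wE; transitivity
    (wd R a * (leadc le s *: wd R (lead le s) + tail s) * wd R b).
    by apply: (congr1 (fun x => wd R a * x * wd R b)); exact: lead_tail.
  exact: sandwich_lin_wd.
suff [g [Kg Ig]] : reducible (wd R a * tail s * wd R b).
  exists (- (leadc le s)^-1 *: g); split; first exact: spanBWZ.
  rewrite (solve_expand g lc0 asbE); apply: idealZ; apply: idealD.
    by apply: ideal_rmul; apply: ideal_lmul; exact: sub_gen_smallest.
  exact: idealZ.
have : forall v, v \in msupp (wd R a * tail s * wd R b) -> wlt le v w.
  move=> v /msupp_sandwich[u /tail_lt us ->].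
  by rewrite wE; exact: wlt_cat.
move: (wd R a * tail s * wd R b) => h lth; rewrite [h]monalgE big_seq.
elim/big_rec: _ => // v h' vh red'; rewrite malgU_scale.
by apply: (redD) => //; apply: IH; exact: lth.
Qed.

End CompositionDiamond.

(** * The involution *)

Section Involution.
Context (R : realType) (m : nat).
Implicit Types (f g : falg R m) (u v w : word m) (c : R[i]).

Lemma wstar_cat u v : wstar (u ++ v) = wstar v ++ wstar u.
Proof. by rewrite /wstar map_cat rev_cat. Qed.

Lemma wstarK : involutive (@wstar m).
Proof.
move=> u; rewrite /wstar map_rev revK -map_comp -[RHS]map_id.
by apply: eq_map => -[x e] /=; rewrite negbK.
Qed.

Let star_termD w : {morph (fun c => c^* *: wd R (wstar w)) : c d / c + d}.
Proof. by move=> c d; rewrite rmorphD scalerDl. Qed.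

Lemma star0 : star 0 = 0 :> falg R m.
Proof. exact: (supp_sum0 (fun w c => c^* *: wd R (wstar w))). Qed.

Lemma starD f g : star (f + g) = star f + star g.
Proof. exact: (supp_sumD star_termD). Qed.

Lemma starU c w : star (c *: wd R w) = c^* *: wd R (wstar w).
Proof. exact: (supp_sumU star_termD). Qed.

Lemma star_lin_wd c w f :
  star (c *: wd R w + f) = c^* *: wd R (wstar w) + star f.
Proof. by rewrite starD starU. Qed.

Lemma starZ c f : star (c *: f) = c^* *: star f.
Proof.
apply: (supp_sumZ star_termD); [exact: scaler0|exact: scalerDr|].
by move=> w d; rewrite rmorphM scalerA.
Qed.

Lemma starB f g : star (f - g) = star f - star g.
Proof. by rewrite starD -scaleN1r starZ rmorphN1 scaleN1r. Qed.

Lemma starK : involutive (@star R m).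
Proof.
elim/falg_ind=> [|c w f IH]; first by rewrite star0 star0.
transitivity (star (c^* *: wd R (wstar w) + star f)).
  by congr star; exact: star_lin_wd.
by rewrite [LHS]star_lin_wd conjCK wstarK IH.
Qed.

Lemma star_wdM u f : star (wd R u * f) = star f * wd R (wstar u).
Proof.
elim/falg_ind: f => [|c w f IH]; first by rewrite mulr0 star0 mul0r.
have -> : wd R u * (c *: wd R w + f) = c *: wd R (u ++ w) + wd R u * f.
  rewrite mulrDr falg_scalerAr.
  by apply: (congr1 (fun x => c *: x + _)); exact: wdM.
rewrite [LHS]star_lin_wd [in RHS]star_lin_wd IH [RHS]mulrDl -scalerAl.
by rewrite wstar_cat; apply: (congr1 (fun x => c^* *: x + _)); rewrite wdM.
Qed.

Lemma starM f g : star (f * g) = star g * star f.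
Proof.
elim/falg_ind: f => [|c w f IH]; first by rewrite mul0r star0 mulr0.
rewrite mulrDl -scalerAl starD IH starZ star_wdM starD starU mulrDr.
by rewrite falg_scalerAr.
Qed.

End Involution.

(** * Normal forms and the right regular representation *)

Section NormalForm.
Context (R : realType) (m : nat).
Context (le : rel (letter m)) (le_lin : linear_order le).
Context (S : set (falg R m)) (Scomp : closed_under_compositions le S).
Implicit Types (f g : falg R m) (c : R[i]) (w : word m).

Lemma reduce_spec f :
  spanBW le S (reduce le S f) /\ ideal S (f - reduce le S f).
Proof.
have [g Pg] := normal_form_exists le_lin Scomp f.
exact: (xgetI 0 (P := [set g | spanBW le S g /\ ideal S (f - g)]) Pg).
Qed.

Lemma spanBW_reduce f : spanBW le S (reduce le S f).
Proof. by have [] := reduce_spec f. Qed.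

Lemma reduce_unique f g : spanBW le S g -> ideal S (f - g) -> reduce le S f = g.
Proof.
move=> Kg Ig; have [Kr Ir] := reduce_spec f; apply/eqP; rewrite -subr_eq0.
apply/eqP/(spanBW_ideal_eq0 le_lin Scomp).
  by rewrite -scaleN1r; apply: spanBWD => //; apply: spanBWZ.
by have := idealB Ig Ir; rewrite opprB addrC addrA subrK.
Qed.

Lemma reduce_id f : spanBW le S f -> reduce le S f = f.
Proof.
by move=> Kf; apply: reduce_unique => //; rewrite subrr; exact: ideal0.
Qed.

Lemma reduce_congr f g : ideal S (f - g) -> reduce le S f = reduce le S g.
Proof.
have [Kr Ir] := reduce_spec g => Ifg; apply: reduce_unique => //.
exact: ideal_trans Ifg Ir.
Qed.

Lemma reduce_lin c f g :
  reduce le S (c *: f + g) = c *: reduce le S f + reduce le S g.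
Proof.
have [[Kf If] [Kg Ig]] := (reduce_spec f, reduce_spec g).
apply: reduce_unique; first by apply: spanBWD => //; apply: spanBWZ.
by rewrite opprD addrACA -scalerBr; apply: idealD => //; apply: idealZ.
Qed.

Lemma reduce_eq0 f : reduce le S f = 0 -> ideal S f.
Proof. by have [_] := reduce_spec f => /[swap] ->; rewrite subr0. Qed.

Lemma normal_form_qpi f : normal_form le (qpi S f) = reduce le S f.
Proof. by apply: reduce_congr; exact: ideal_qrepr. Qed.

Lemma right_regularE (z : quotalg S) f :
  right_regular le z f = reduce le S (f * qrepr z).
Proof. by rewrite -normal_form_qpi qpiM qreprK. Qed.

Lemma reduceMl f g : reduce le S (reduce le S f * g) = reduce le S (f * g).
Proof.
apply/esym/reduce_congr; rewrite -mulrBl; apply: ideal_rmul.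
by have [] := reduce_spec f.
Qed.

(** Each identity of a module holds for the representatives in F_* modulo the
    ideal, and normal forms only depend on classes modulo the ideal. *)
Lemma right_regular_repr :
  is_representation (spanBW le S) (@right_regular R m le S).
Proof.
have addq (c : R[i]) (z w : quotalg S) :
    ideal S (qrepr (c *: z + w) - (c *: qrepr z + qrepr w)).
  suff <- : qpi S (c *: qrepr z + qrepr w) = c *: z + w by exact: ideal_qrepr.
  by rewrite qpiD qpiZ !qreprK.
have mulq (z w : quotalg S) : ideal S (qrepr (z * w) - qrepr z * qrepr w).
  suff <- : qpi S (qrepr z * qrepr w) = z * w by exact: ideal_qrepr.
  by rewrite qpiM !qreprK.
split.
- by move=> z f _; exact: spanBW_reduce.
- move=> z c f g _ _; rewrite !right_regularE mulrDl -scalerAl.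
  exact: reduce_lin.
- move=> c z w f _; rewrite !right_regularE -reduce_lin; apply: reduce_congr.
  have -> : c *: (f * qrepr z) + f * qrepr w = f * (c *: qrepr z + qrepr w).
    by rewrite mulrDr falg_scalerAr.
  by rewrite -mulrBr; exact: ideal_lmul.
- move=> f Kf; rewrite right_regularE -[RHS](reduce_id Kf).
  apply: reduce_congr; rewrite -[X in _ - X]mulr1 -mulrBr; apply: ideal_lmul.
  exact: ideal_qrepr.
- move=> z w f _; rewrite !right_regularE [RHS]reduceMl; apply: reduce_congr.
  by rewrite -mulrA -mulrBr; exact: ideal_lmul.
Qed.

(** The normal form of 1 is used instead of the word 1, which is not in BW when
    the ideal is the whole algebra. *)
Lemma right_regular_faithful :
  is_faithful (spanBW le S) (@right_regular R m le S).
Proof.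
move=> z z0; exists (reduce le S 1); first exact: spanBW_reduce.
apply: contra_neq z0; rewrite right_regularE reduceMl mul1r => /reduce_eq0 Iz.
have qpi0 : qpi S 0 = 0 by apply: (addIr (qpi S 0)); rewrite -qpiD !add0r.
by rewrite -[z]qreprK -qpi0; apply/qpiP; rewrite subr0; apply/asboolP.
Qed.

End NormalForm.

(** * The form as a functional of products *)

Section MomentFunctional.
Context (R : realType) (m : nat).
Context (le : rel (letter m)) (le_lin : linear_order le).
Context (S : set (falg R m)) (Scomp : closed_under_compositions le S).
Context (phi : word m -> nat) (xi : nat -> R).
Implicit Types (f g : falg R m) (c : R[i]) (u v w : word m).

Let opH_word w : falg R m :=
  let u := take (size w)./2 w in if w == u ++ wstar u then wd R u else 0.

Let opH_termD w : {morph (fun c => c *: opH_word w) : c d / c + d}.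
Proof. by move=> c d; exact: scalerDl. Qed.

Let functT_termD w :
  {morph (fun c : R[i] => c * (xi (phi w))%:C%C) : c d / c + d}.
Proof. by move=> c d; exact: mulrDl. Qed.

Lemma opHE f : opH f = \sum_(w <- msupp f) f@_w *: opH_word w.
Proof.
apply: eq_bigr => w _; rewrite /opH_word.
by case: (w == _) => //; rewrite scaler0.
Qed.

Lemma opHD f g : opH (f + g) = opH f + opH g.
Proof. by rewrite !opHE; exact: (supp_sumD opH_termD). Qed.

Lemma opHZ c f : opH (c *: f) = c *: opH f.
Proof.
rewrite !opHE; apply: (supp_sumZ opH_termD); [exact: scaler0|exact: scalerDr|].
by move=> w d; rewrite scalerA.
Qed.

Lemma opH_palindrome u : opH (wd R (u ++ wstar u)) = wd R u.
Proof.
rewrite opHE -[wd R (_ ++ _)]scale1r [LHS](supp_sumU opH_termD) scale1r.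
rewrite /opH_word.
have -> : (size (u ++ wstar u))./2 = size u.
  by rewrite size_cat size_rev size_map addnn doubleK.
by rewrite take_size_cat // eqxx.
Qed.

Lemma functTD f g : functT phi xi (f + g) = functT phi xi f + functT phi xi g.
Proof. exact: (supp_sumD functT_termD). Qed.

Lemma functTU c w : functT phi xi (c *: wd R w) = c * (xi (phi w))%:C%C.
Proof. exact: (supp_sumU functT_termD). Qed.

Lemma functTZ c f : functT phi xi (c *: f) = c * functT phi xi f.
Proof.
apply: (supp_sumZ functT_termD); [exact: mulr0|exact: mulrDr|].
by move=> w d; rewrite mulrA.
Qed.

(** The functional tau = T o H o R_S, seen on all of F_*. *)
Definition moment f : R[i] := functT phi xi (opH (reduce le S f)).

Lemma moment_lin c f g : moment (c *: f + g) = c * moment f + moment g.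
Proof. by rewrite /moment reduce_lin // opHD opHZ functTD functTZ. Qed.

Lemma moment_congr f g : ideal S (f - g) -> moment f = moment g.
Proof. by move=> Ifg; rewrite /moment (reduce_congr le_lin Scomp Ifg). Qed.

Lemma moment0 : moment 0 = 0.
Proof. by have := moment_lin (-1) 0 0; rewrite scaler0 addr0 mulN1r addNr. Qed.

Lemma momentZ c f : moment (c *: f) = c * moment f.
Proof. by have := moment_lin c f 0; rewrite moment0 !addr0. Qed.

Lemma moment_sum (I : Type) (r : seq I) (F : I -> falg R m) :
  moment (\sum_(i <- r) F i) = \sum_(i <- r) moment (F i).
Proof.
elim: r => [|i r IH]; first by rewrite !big_nil moment0.
rewrite !big_cons -IH -[F i]scale1r moment_lin scale1r.
by rewrite mul1r.
Qed.

Hypothesis BW_palindrome : forall d, BW le S d -> BW le S (d ++ wstar d).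

(** On the diagonal the value of the form is prescribed separately; it agrees
    with the functional because u star(u) stays in BW, so that it is its own
    normal form. *)
Lemma xi_form_wordE u v : BW le S u ->
  xi_form_word le S phi xi u v = moment (wd R (u ++ wstar v)).
Proof.
move=> Ku; rewrite /xi_form_word; case: eqP => // <-.
rewrite /moment reduce_id //.
  by rewrite opH_palindrome -[wd R u]scale1r functTU mul1r.
by move=> w; rewrite msupp_wd => /eqP->; exact: BW_palindrome.
Qed.

Lemma mul_star_expand f g : f * star g = \sum_(u <- msupp f)
  \sum_(v <- msupp g) (f@_u * (g@_v)^*) *: wd R (u ++ wstar v).
Proof.
rewrite {1}[f]monalgE mulr_suml; apply: eq_bigr => u _.
rewrite mulr_sumr; apply: eq_bigr => v _; rewrite malgU_scale falg_scalerAr.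
by rewrite -scalerAl scalerA wdM mulrC.
Qed.

Lemma xi_formE f g : spanBW le S f ->
  xi_form le S phi xi f g = moment (f * star g).
Proof.
move=> Kf; rewrite mul_star_expand moment_sum; apply: eq_big_seq => u uf.
rewrite moment_sum; apply: eq_bigr => v _.
by rewrite momentZ xi_form_wordE //; exact: Kf.
Qed.

Hypothesis Ssym : symmetric_set S.

Lemma ideal_star f : ideal S f -> ideal S (star f).
Proof. by move=> If; rewrite -Ssym; exists f. Qed.

(** Both sides are the value of the functional at f z star(g): normal forms and
    representatives change its argument by elements of the ideal, which the
    involution preserves. *)
Lemma xi_form_adjoint (z : quotalg S) f g :
  spanBW le S f -> spanBW le S g ->
  xi_form le S phi xi (right_regular le z f) g =
  xi_form le S phi xi f (right_regular le (qstar z) g).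
Proof.
move=> Kf Kg; rewrite !right_regularE //.
rewrite [LHS]xi_formE; last exact: spanBW_reduce.
rewrite [RHS](xi_formE _ Kf).
have diff h : ideal S (reduce le S h - h).
  have [_ /(idealZ (-1))] := reduce_spec le_lin Scomp h.
  by rewrite scaleN1r opprB.
transitivity (moment (f * qrepr z * star g)).
  by apply: moment_congr; rewrite -mulrBl; apply: ideal_rmul; exact: diff.
apply/esym/moment_congr; rewrite -mulrA -mulrBr; apply: ideal_lmul.
have -> : qrepr z * star g = star (g * star (qrepr z)) by rewrite starM starK.
rewrite -starB; apply: ideal_star.
apply: (ideal_trans (diff _)); rewrite -mulrBr; apply: ideal_lmul.
exact: ideal_qrepr.
Qed.

End MomentFunctional.

Theorem theorem6 (R : realType) (m : nat) (le : rel (letter m))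
    (S : set (falg R m)) (phi : word m -> nat) (xi : nat -> nat) :
  linear_order le ->
  strictly_non_expanding le S ->
  enumeration le S phi ->
  (forall k, (0 < k)%N -> (0 < xi k)%N) ->
  positive_definite (spanBW le S) (xi_form le S phi (fun k => (xi k)%:R)) ->
  is_star_representation (spanBW le S) (xi_form le S phi (fun k => (xi k)%:R))
    (@right_regular R m le S) /\
  is_faithful (spanBW le S) (@right_regular R m le S).
Proof.
move=> le_lin [[Ssym Scomp _] BW_pal] _ _ _; split; last first.
  exact: right_regular_faithful.
split; first exact: right_regular_repr.
by move=> z f g Kf Kg; apply: xi_form_adjoint.
Qed.
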